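(* Let $L$ be a loop. (1) Let $(N,\kappa,\Sigma)$ be a data triple of an Albert decomposition of $L$, with $\kappa:K\to L/N$, and let $\mathcal{L}(N,\kappa,\Sigma)$ be the Albert extension determined by it. Then the map $\mathcal{F}:\mathcal{L}(N,\kappa,\Sigma)\to L$, $\mathcal{F}(\sigma,s)=l_\sigma s$, where $\{l_\sigma\}=\Sigma\cap\kappa(\sigma)$, is an Albert decomposition of $L$ with respect to $N$ with underlying isomorphism $\kappa:K\to L/N$. (2) Conversely, let $\mathcal{F}:K\times^{\triangledown}N\to L$ be an Albert decomposition of $L$ with respect to a normal subloop $N$. Define $\kappa$ by $\kappa(\sigma)=\mathcal{F}(\sigma,e)N$ and $\Sigma=\{\mathcal{F}(\sigma,e);\ \sigma\in K\}$. Then $(N,\kappa,\Sigma)$ is a data triple of an Albert decomposition of $L$ and $K\times^{\triangledown}N=\mathcal{L}(N,\kappa,\Sigma)$.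
   Context: Let $K$, $N$ be loops with identities $\epsilon$, $e$. An Albert extension $K\times^{\triangledown}N$ is the loop on $K\times N$ with multiplication $(\alpha,a)(\beta,b)=(\alpha\beta,\triangledown_{\alpha,\beta}(a,b))$, where $\triangledown_{\alpha,\beta}:N\times N\to N$ ($\alpha,\beta\in K$) are quasigroup multiplications such that (a) $\triangledown_{\epsilon,\epsilon}$ is the multiplication of $N$; (b) $e$ is a left identity of $\triangledown_{\epsilon,\alpha}$ for all $\alpha$; (c) $e$ is a two-sided identity of $\triangledown_{\alpha,\epsilon}$ for all $\alpha$. Let $N$ be a normal subloop of a loop $L$ (i.e. the kernel of a homomorphism of $L$); $e$ is the identity of $L$. A left transversal to $N$ in $L$ is a set $\Sigma\subset L$ consisting of exactly one representative of each left coset of $N$, with $e\in\Sigma$. An Albert decomposition of $L$ with respect to $N$ is an isomorphism $\mathcal{F}$ of an Albert extension $K\times^{\triangledown}N$ onto $L$ with $\mathcal{F}(\epsilon,t)=t$ for all $t\in N$; its underlying isomorphism is the map $K\to L/N$, $\sigma\mapsto\mathcal{F}(\sigma,e)N$. A data triple $(N,\kappa,\Sigma)$ of an Albert decomposition of $L$ consists of a normal subloop $N$ of $L$, an isomorphism $\kappa$ of a loop $K$ onto $L/N$, and a left transversal $\Sigma$ to $N$ in $L$. For a data triple put $\{l_\sigma\}=\Sigma\cap\kappa(\sigma)$ and $\triangledown_{\sigma,\tau}(s,t)=l_{\sigma\tau}\backslash(l_\sigma s\cdot l_\tau t)$ for $\sigma,\tau\in K$, $s,t\in N$, where $x\backslash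 y$ denotes the unique $z$ with $xz=y$; the Albert extension on $K\times N$ with these multiplications is denoted $\mathcal{L}(N,\kappa,\Sigma)$. *)

(* Defs.v *)
From HB Require Import structures.
From mathcomp Require Import all_boot.
From mathcomp Require Import boolp classical_sets.

Set Implicit Arguments.
Unset Strict Implicit.
Unset Printing Implicit Defensive.

Local Open Scope classical_set_scope.
Local Open Scope group_scope.

Definition quasigroup (T : Type) (op : T -> T -> T) : Prop :=
  forall a b, (exists! x, op a x = b) /\ (exists! y, op y a = b).

HB.mixin Record UMagma_isLoop L of UMagma L := {
  mulg_quasigroup : quasigroup (@mul L)
}.

#[short(type="loopType")]
HB.structure Definition Loop := {L of UMagma_isLoop L & UMagma L}.

Definition loop_iso (A B : loopType) (f : A -> B) : Prop :=
  {morph f : x y / x * y} /\ bijective f.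

(* The unique z such that x * z = y; the default 1 is never used. *)
Definition ldiv (L : loopType) (x y : L) : L := xget 1 [set z | x * z = y].

Section LoopTheory.
Variable L : loopType.
Implicit Types x y z : L.

Lemma loop_mulgI x : injective (mul x).
Proof.
move=> y z e; have [[w [_ u]] _] := mulg_quasigroup x (x * z).
by rewrite -(u y e) -(u z erefl).
Qed.

Lemma loop_mulIg x : injective (mul^~ x).
Proof.
move=> y z e; have [_ [w [_ u]]] := mulg_quasigroup x (z * x).
by rewrite -(u y e) -(u z erefl).
Qed.

Lemma ldivK x y : x * ldiv x y = y.
Proof.
have [[w [e _]] _] := mulg_quasigroup x y.
exact: (@xgetI _ 1 [set z | x * z = y] w e).
Qed.

Lemma ldivE x y z : x * z = y -> ldiv x y = z.
Proof. by move=> <-; apply: (@loop_mulgI x); rewrite ldivK. Qed.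

End LoopTheory.

Lemma loop_morph1 (L M : loopType) (f : L -> M) :
  {morph f : x y / x * y} -> f 1 = 1.
Proof. by move=> fM; apply: (@loop_mulgI _ (f 1)); rewrite -fM !mulg1. Qed.

Record normal_subloop (L : loopType) := NormalSubloop {
  nset :> set L;
  nset_kernel : exists (M : loopType) (f : {multiplicative L -> M}),
    nset = [set x | f x = 1]
}.

Definition lcoset (L : loopType) (N : set L) (x : L) : set L :=
  [set x * n | n in N].

Section NormalSubloop.
Variables (L : loopType) (N : normal_subloop L).
Implicit Types x y : L.

Lemma lcoset_fiber : exists (M : loopType) (f : {multiplicative L -> M}),
  (forall x, nset N x <-> f x = 1) /\ (forall x y, lcoset N x y <-> f y = f x).
Proof.
case: N => A /= [M [f ->]]; exists M, f; split=> // x y; split=> /=.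
  by move=> [n /= fn <-]; rewrite gmulfM fn mulg1.
move=> e; exists (ldiv x y); last exact: ldivK.
by apply: (@loop_mulgI _ (f x)); rewrite /= -gmulfM ldivK mulg1.
Qed.

Lemma normal_subloop1 : nset N 1.
Proof.
have [M [f [NE _]]] := lcoset_fiber; apply/NE.
by apply: loop_morph1 => x y; rewrite gmulfM.
Qed.

Lemma normal_subloopM x y : nset N x -> nset N y -> nset N (x * y).
Proof.
have [M [f [NE _]]] := lcoset_fiber => /NE fx /NE fy.
by apply/NE; rewrite gmulfM fx fy mulg1.
Qed.

Lemma normal_subloop_ldiv x y z :
  x * z = y -> nset N x -> nset N y -> nset N z.
Proof.
have [M [f [NE _]]] := lcoset_fiber => /(congr1 f).
by rewrite gmulfM => e /NE fx /NE fy; apply/NE; rewrite -fy -e fx mul1g.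
Qed.

Lemma normal_subloop_rdiv x y z :
  z * x = y -> nset N x -> nset N y -> nset N z.
Proof.
have [M [f [NE _]]] := lcoset_fiber => /(congr1 f).
by rewrite gmulfM => e /NE fx /NE fy; apply/NE; rewrite -fy -e fx mulg1.
Qed.

Lemma lcoset1 : lcoset N 1 = N.
Proof.
apply/seteqP; split=> x; first by move=> [n Nn <-]; rewrite mul1g.
by move=> Nx; exists x; rewrite ?mul1g.
Qed.

Lemma lcoset_eqP x y : lcoset N x = lcoset N y <-> lcoset N y x.
Proof.
have [M [f [_ CE]]] := lcoset_fiber; split=> [<-|/CE e]; first exact/CE.
by apply/seteqP; split=> z /CE fz; apply/CE; rewrite fz ?e.
Qed.

Lemma lcoset_refl x : lcoset N x x.
Proof. exact/lcoset_eqP. Qed.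

Lemma lcosetM x y :
  [set a * b | a in lcoset N x & b in lcoset N y] = lcoset N (x * y).
Proof.
have [M [f [_ CE]]] := lcoset_fiber; apply/seteqP; split=> z.
  by move=> [a /CE fa [b /CE fb <-]]; apply/CE; rewrite !gmulfM fa fb.
move=> /CE fz; exists x; first exact: lcoset_refl.
exists (ldiv x z); last exact: ldivK.
by apply/CE/(@loop_mulgI _ (f x)); rewrite -!gmulfM ldivK.
Qed.

Lemma lcoset_ldiv x y z : lcoset N (x * y) (x * z) -> lcoset N y z.
Proof.
have [M [f [_ CE]]] := lcoset_fiber => /CE; rewrite !gmulfM => e.
by apply/CE; apply: loop_mulgI e.
Qed.

Lemma lcoset_rdiv x y z : lcoset N (y * x) (z * x) -> lcoset N y z.
Proof.
have [M [f [_ CE]]] := lcoset_fiber => /CE; rewrite !gmulfM => e.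
by apply/CE; apply: loop_mulIg e.
Qed.

Definition subloop : Type := set_type N.
HB.instance Definition _ := SubChoice.on subloop.

Definition subloop_of x (Nx : nset N x) : subloop := exist _ x (mem_set Nx).

Lemma subloopP (s : subloop) : nset N (val s).
Proof. exact: set_mem (valP s). Qed.

Definition subloop_mul (s t : subloop) : subloop :=
  subloop_of (normal_subloopM (subloopP s) (subloopP t)).

HB.instance Definition _ := hasMul.Build subloop subloop_mul.

Lemma subloop_mul1g : left_id (subloop_of normal_subloop1) (@mul subloop).
Proof. by move=> s; apply: val_inj; rewrite /= mul1g. Qed.

Lemma subloop_mulg1 : right_id (subloop_of normal_subloop1) (@mul subloop).
Proof. by move=> s; apply: val_inj; rewrite /= mulg1. Qed.

HB.instance Definition _ :=
  Magma_isUMagma.Build subloop subloop_mul1g subloop_mulg1.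

Lemma subloop_quasigroup : quasigroup (@mul subloop).
Proof.
move=> s t; have Ns := subloopP s; have Nt := subloopP t; split.
  have Nd := normal_subloop_ldiv (ldivK _ _) Ns Nt.
  exists (subloop_of Nd); split; first by apply: val_inj; rewrite /= ldivK.
  by move=> u /(congr1 val) /= e; apply: val_inj; rewrite /= (ldivE e).
have [_ [d [e _]]] := mulg_quasigroup (val s) (val t).
have Nd := normal_subloop_rdiv e Ns Nt.
exists (subloop_of Nd); split; first exact: val_inj.
move=> u /(congr1 val) /= eu; apply: val_inj => /=.
by apply: (@loop_mulIg _ (val s)); rewrite /= e.
Qed.

HB.instance Definition _ := UMagma_isLoop.Build subloop subloop_quasigroup.

(* The product of two cosets is their product as subsets of L. *)
Definition quotient : Type := set_type (range (lcoset N)).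
HB.instance Definition _ := SubChoice.on quotient.

Definition coset (x : L) : quotient :=
  exist _ (lcoset N x) (mem_set (imageT (lcoset N) x)).

Lemma coset_surj (C : quotient) : exists x, C = coset x.
Proof. by have [x _ e] := set_mem (valP C); exists x; apply: val_inj. Qed.

Lemma coset_eqP x y : coset x = coset y <-> lcoset N y x.
Proof.
split=> [/(congr1 val) /= e|/lcoset_eqP e]; first exact/lcoset_eqP.
exact: val_inj.
Qed.

Lemma quotient_mul_subproof (C D : quotient) :
  range (lcoset N) [set a * b | a in val C & b in val D].
Proof.
have [x ->] := coset_surj C; have [y ->] := coset_surj D.
by rewrite /= lcosetM; exists (x * y).
Qed.

Definition quotient_mul (C D : quotient) : quotient :=
  exist _ [set a * b | a in val C & b in val D]
    (mem_set (quotient_mul_subproof C D)).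

HB.instance Definition _ := hasMul.Build quotient quotient_mul.

Lemma cosetM : {morph coset : x y / x * y}.
Proof. by move=> x y; apply: val_inj; rewrite /= lcosetM. Qed.

Lemma quotient_mul1g : left_id (coset 1) (@mul quotient).
Proof. by move=> C; have [x ->] := coset_surj C; rewrite -cosetM mul1g. Qed.

Lemma quotient_mulg1 : right_id (coset 1) (@mul quotient).
Proof. by move=> C; have [x ->] := coset_surj C; rewrite -cosetM mulg1. Qed.

HB.instance Definition _ :=
  Magma_isUMagma.Build quotient quotient_mul1g quotient_mulg1.

Lemma quotient_quasigroup : quasigroup (@mul quotient).
Proof.
move=> C D; have [x ->] := coset_surj C; have [y ->] := coset_surj D; split.
  exists (coset (ldiv x y)); split; first by rewrite -cosetM ldivK.
  move=> E; have [z ->] := coset_surj E; rewrite -cosetM => /esym /coset_eqP.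
  by rewrite -[y in lcoset _ _ y](ldivK x y) => /lcoset_ldiv /coset_eqP.
have [_ [d [e _]]] := mulg_quasigroup x y.
exists (coset d); split; first by rewrite -cosetM e.
move=> E; have [z ->] := coset_surj E; rewrite -cosetM => /esym /coset_eqP.
by rewrite -e => /lcoset_rdiv /coset_eqP.
Qed.

HB.instance Definition _ := UMagma_isLoop.Build quotient quotient_quasigroup.

End NormalSubloop.

Record albert_extension (K N : loopType) := AlbertExtension {
  nabla :> K -> K -> N -> N -> N;
  nabla_quasigroup : forall alpha beta, quasigroup (nabla alpha beta);
  nabla11 : forall a b, nabla 1 1 a b = a * b;
  nabla1_left_id : forall alpha, left_id 1 (nabla 1 alpha);
  nabla_1_left_id : forall alpha, left_id 1 (nabla alpha 1);
  nabla_1_right_id : forall alpha, right_id 1 (nabla alpha 1)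
}.

(* The alias keeps this loop apart from the direct product of K and N, which
   the library provides on the type K * N. *)
Definition albert_loop (K N : loopType) (A : albert_extension K N) : Type :=
  (K * N)%type.

Section AlbertLoop.
Variables (K N : loopType) (A : albert_extension K N).
Local Notation albert_loop := (albert_loop A).

HB.instance Definition _ := Choice.on albert_loop.

Definition albert_mul (p q : albert_loop) : albert_loop :=
  (p.1 * q.1, A p.1 q.1 p.2 q.2).

HB.instance Definition _ := hasMul.Build albert_loop albert_mul.

Lemma albert_mul1g : left_id ((1, 1) : albert_loop) (@mul albert_loop).
Proof.
by move=> [a s]; congr pair; rewrite /= ?mul1g ?nabla1_left_id.
Qed.

Lemma albert_mulg1 : right_id ((1, 1) : albert_loop) (@mul albert_loop).
Proof.
by move=> [a s]; congr pair; rewrite /= ?mulg1 ?nabla_1_right_id.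
Qed.

HB.instance Definition _ :=
  Magma_isUMagma.Build albert_loop albert_mul1g albert_mulg1.

Lemma albert_quasigroup : quasigroup (@mul albert_loop).
Proof.
move=> [a s] [b t]; split.
  have [[c [ec uc]] _] := mulg_quasigroup a b.
  have [[u [eu uu]] _] := nabla_quasigroup A a c s t.
  exists (c, u); split; first by congr pair.
  by move=> [c' u'] [/uc <- /uu <-].
have [_ [c [ec uc]]] := mulg_quasigroup a b.
have [_ [u [eu uu]]] := nabla_quasigroup A c a s t.
exists (c, u); split; first by congr pair.
by move=> [c' u'] [/uc <- /uu <-].
Qed.

HB.instance Definition _ := UMagma_isLoop.Build albert_loop albert_quasigroup.

End AlbertLoop.

Definition left_transversal (L : loopType) (N Sigma : set L) : Prop :=
  (forall x, exists! l, (Sigma `&` lcoset N x) l) /\ Sigma 1.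

Definition albert_decomposition (L : loopType) (N : normal_subloop L)
    (K : loopType) (A : albert_extension K (subloop N))
    (F : albert_loop A -> L) : Prop :=
  loop_iso F /\ forall t : subloop N, F (1, t) = val t.

Definition underlying (L : loopType) (N : normal_subloop L)
    (K : loopType) (A : albert_extension K (subloop N))
    (F : albert_loop A -> L) (sigma : K) : quotient N :=
  coset N (F (sigma, 1)).

Definition data_triple (L : loopType) (N : normal_subloop L) (K : loopType)
    (kappa : K -> quotient N) (Sigma : set L) : Prop :=
  loop_iso kappa /\ left_transversal N Sigma.

(* The unique element of the intersection of Sigma with kappa sigma; the
   default 1 is never used for a data triple. *)
Definition rep (L : loopType) (N : normal_subloop L) (K : loopType)
    (kappa : K -> quotient N) (Sigma : set L) (sigma : K) : L :=
  xget 1 (Sigma `&` val (kappa sigma)).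

Section TripleExtension.
Variables (L : loopType) (N : normal_subloop L) (K : loopType).
Variables (kappa : K -> quotient N) (Sigma : set L).
Hypothesis T : data_triple kappa Sigma.

Local Notation l := (rep kappa Sigma).

Lemma rep_spec sigma : Sigma (l sigma) /\ kappa sigma = coset N (l sigma).
Proof.
have [x ex] := coset_surj (kappa sigma).
have [_ [/(_ x) [y [Py _]] _]] := T.
have := @xgetI _ 1 (Sigma `&` val (kappa sigma)) y.
rewrite -/(l sigma) ex /= => /(_ Py) [Sl Cl]; split=> //.
by apply/esym/coset_eqP.
Qed.

Lemma rep1 : l 1 = 1.
Proof.
have [[kM _] [tr S1]] := T; have [Sl /esym] := rep_spec 1.
rewrite (loop_morph1 kM) => /coset_eqP Cl.
have [y [_ uy]] := tr 1; rewrite -(uy _ (conj Sl Cl)).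
by apply: uy; split=> //; exact: lcoset_refl.
Qed.

Lemma repM sigma tau : coset N (l (sigma * tau)) = coset N (l sigma * l tau).
Proof.
have [[kM _] _] := T.
by rewrite cosetM -!(rep_spec _).2 kM.
Qed.

Lemma coset_mulN x (s : subloop N) : coset N (x * val s) = coset N x.
Proof. by apply/coset_eqP; exists (val s) => //; exact: subloopP. Qed.

Lemma ldiv_coset x y : coset N x = coset N y -> nset N (ldiv x y).
Proof.
move=> /esym/coset_eqP; rewrite -[y in lcoset _ _ y](ldivK x).
by rewrite -{1}[x]mulg1 => /lcoset_ldiv; rewrite lcoset1.
Qed.

Lemma triple_nabla_subproof sigma tau (s t : subloop N) :
  nset N (ldiv (l (sigma * tau)) ((l sigma * val s) * (l tau * val t))).
Proof.
apply: ldiv_coset; rewrite repM cosetM.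
by rewrite -(coset_mulN (l sigma) s) -(coset_mulN (l tau) t) -cosetM.
Qed.

Definition triple_nabla (sigma tau : K) (s t : subloop N) : subloop N :=
  subloop_of (triple_nabla_subproof sigma tau s t).

Lemma triple_nablaK sigma tau s t :
  l (sigma * tau) * val (triple_nabla sigma tau s t)
    = (l sigma * val s) * (l tau * val t).
Proof. exact: ldivK. Qed.

Lemma triple_nablaE sigma tau s t u :
  (l sigma * val s) * (l tau * val t) = l (sigma * tau) * val u ->
  triple_nabla sigma tau s t = u.
Proof. by move=> e; apply: val_inj; apply: ldivE. Qed.

Lemma triple_nabla_quasigroup sigma tau : quasigroup (triple_nabla sigma tau).
Proof.
move=> s t; split.
  pose a := ldiv (l sigma * val s) (l (sigma * tau) * val t).
  have ea : (l sigma * val s) * a = l (sigma * tau) * val t by exact: ldivK.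
  have Nx : nset N (ldiv (l tau) a).
    apply/ldiv_coset/(@loop_mulgI _ (coset N (l sigma))).
    by rewrite -(coset_mulN (l sigma) s) -[RHS]cosetM ea !coset_mulN repM cosetM.
  exists (subloop_of Nx); split; first by apply: triple_nablaE; rewrite /= ldivK.
  move=> u eu; apply: val_inj; apply: ldivE.
  by apply: (@loop_mulgI _ (l sigma * val s)); rewrite ea -triple_nablaK eu.
have [_ [a [ea _]]] :=
  mulg_quasigroup (l tau * val s) (l (sigma * tau) * val t).
have Nx : nset N (ldiv (l sigma) a).
  apply/ldiv_coset/(@loop_mulIg _ (coset N (l tau))).
  by rewrite /= -{2}(coset_mulN (l tau) s) -[RHS]cosetM ea !coset_mulN repM cosetM.
exists (subloop_of Nx); split; first by apply: triple_nablaE; rewrite /= ldivK.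
move=> u eu; apply: val_inj; apply: ldivE.
by apply: (@loop_mulIg _ (l tau * val s)); rewrite /= ea -triple_nablaK eu.
Qed.

Lemma triple_nabla11 s t : triple_nabla 1 1 s t = s * t.
Proof. by apply: triple_nablaE; rewrite mulg1 rep1 !mul1g. Qed.

Lemma triple_nabla1_left_id alpha : left_id 1 (triple_nabla 1 alpha).
Proof. by move=> t; apply: triple_nablaE; rewrite rep1 !mul1g. Qed.

Lemma triple_nabla_1_left_id alpha : left_id 1 (triple_nabla alpha 1).
Proof. by move=> t; apply: triple_nablaE; rewrite rep1 !mulg1 mul1g. Qed.

Lemma triple_nabla_1_right_id alpha : right_id 1 (triple_nabla alpha 1).
Proof. by move=> t; apply: triple_nablaE; rewrite rep1 !mulg1. Qed.

Definition triple_extension : albert_extension K (subloop N) :=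
  AlbertExtension triple_nabla_quasigroup triple_nabla11
    triple_nabla1_left_id triple_nabla_1_left_id triple_nabla_1_right_id.

End TripleExtension.

Definition triple_map (L : loopType) (N : normal_subloop L) (K : loopType)
    (kappa : K -> quotient N) (Sigma : set L) (T : data_triple kappa Sigma)
    (p : albert_loop (triple_extension T)) : L :=
  rep kappa Sigma p.1 * val p.2.

(* Main.v *)
(** In an Albert extension (sigma, 1)(1, s) = (sigma, s), so an Albert
    decomposition F satisfies F (sigma, s) = F (sigma, 1) s: it is determined by
    the elements F (sigma, 1), which form a transversal, and the
    multiplicativity of F is then the formula that defines the operations of
    the triple. *)

Require Import Defs.
From mathcomp Require Import all_boot.
From mathcomp Require Import boolp classical_sets.

Local Open Scope classical_set_scope.
Local Open Scope group_scope.

Set Implicit Arguments.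
Unset Strict Implicit.
Unset Printing Implicit Defensive.

(** [bijective] asks for an inverse function; a choice of preimages provides it. *)
Lemma inj_surj_bijective (A B : Type) (f : A -> B) :
  injective f -> (forall y, exists x, f x = y) -> bijective f.
Proof.
by move=> fI /choice[g gK]; exists g => // x; apply: fI; rewrite gK.
Qed.

(** Apart from the operations, the record holds only proofs, which proof irrelevance identifies. *)
Lemma albert_extension_eq (K N : loopType) (A B : albert_extension K N) :
  (forall sigma tau s t, A sigma tau s t = B sigma tau s t) -> A = B.
Proof.
case: A B => [f f1 f2 f3 f4 f5] [g g1 g2 g3 g4 g5] /= fg.
have e : f = g by do 4!apply/funext => ?; exact: fg.
by subst g; congr AlbertExtension; exact: Prop_irrelevance.
Qed.

Section TripleToDecomposition.
Variables (L : loopType) (N : normal_subloop L) (K : loopType).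
Variables (kappa : K -> quotient N) (Sigma : set L).
Hypothesis T : data_triple kappa Sigma.

Lemma coset_triple_map (p : albert_loop (triple_extension T)) :
  coset N (triple_map p) = kappa p.1.
Proof. by rewrite coset_mulN -(rep_spec T p.1).2. Qed.

(** The coset of the image gives back [sigma], and left cancellation then gives back [s]. An element
    [x] is reached from the [sigma] whose [kappa sigma] is its coset, with [s] the left quotient of
    [x] by its representative. *)
Lemma triple_map_bijective : bijective (triple_map (T := T)).
Proof.
have [[_ kB] _] := T; apply: inj_surj_bijective.
  move=> [a s] [b t] e; have /= := congr1 (coset N) e.
  rewrite !coset_triple_map /= => /(bij_inj kB) ab; subst b.
  by move: e => /loop_mulgI /val_inj /= ->.
move=> x; have [k' _ kK] := kB; pose a := k' (coset N x).
have Nd : nset N (ldiv (rep kappa Sigma a) x).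
  by apply: ldiv_coset; rewrite -(rep_spec T a).2 kK.
by exists (a, subloop_of Nd); rewrite /triple_map /= ldivK.
Qed.

Lemma triple_map_decomposition : albert_decomposition (triple_map (T := T)).
Proof.
(* The representative of [kappa 1 = N] is 1, since [Sigma] meets [N] only in 1. *)
split; last by move=> t; rewrite /triple_map /= (rep1 T) mul1g.
split; last exact: triple_map_bijective.
by move=> [a s] [b t]; exact: triple_nablaK.
Qed.

Lemma underlying_triple_map : underlying (triple_map (T := T)) = kappa.
Proof. by apply/funext => a; exact: coset_triple_map. Qed.

End TripleToDecomposition.

Section DecompositionToTriple.
Variables (L : loopType) (N : normal_subloop L) (K : loopType).
Variables (A : albert_extension K (subloop N)) (F : albert_loop A -> L).
Hypothesis FD : albert_decomposition F.

Let FM : {morph F : x y / x * y}. Proof. exact: FD.1.1. Qed.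
Let FB : bijective F. Proof. exact: FD.1.2. Qed.

Local Notation Sigma := [set F (sigma, 1) | sigma in [set: K]].

(** [val s] is [F (1, s)], and 1 is a left identity of [A sigma 1]. *)
Lemma decompositionE sigma (s : subloop N) :
  F (sigma, s) = F (sigma, 1) * val s.
Proof.
by rewrite -FD.2 -FM /mul /= /albert_mul /= mulg1 nabla_1_left_id.
Qed.

Lemma coset_decomposition sigma (s : subloop N) :
  coset N (F (sigma, s)) = underlying F sigma.
Proof. by rewrite decompositionE coset_mulN. Qed.

Lemma decomposition_surj x : exists sigma s, F (sigma, s) = x.
Proof. by have [G _ GK] := FB; case E: (G x) => [a s]; exists a, s; rewrite -E. Qed.

Lemma underlying_inj : injective (underlying F).
Proof.
move=> a b /coset_eqP [n Nn].
(* The element [F (b, 1) * n] is [F (b, n)], so injectivity of [F] compares first components. *)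
by rewrite -[n]/(val (subloop_of Nn)) -decompositionE => /(bij_inj FB) [].
Qed.

Lemma underlying_iso : loop_iso (underlying F).
Proof.
(* [F (a, 1) * F (b, 1)] is [F (a * b, s)] with [s = A a b 1 1], which need not be 1; its coset does
   not depend on [s]. *)
split; first by move=> a b; rewrite -cosetM -FM coset_decomposition.
apply: inj_surj_bijective underlying_inj _ => C.
have [x ->] := coset_surj C; have [a [s <-]] := decomposition_surj x.
by exists a; rewrite coset_decomposition.
Qed.

Lemma decomposition_transversal : left_transversal N Sigma.
Proof.
split; last by exists 1 => //; rewrite FD.2.
move=> x; have [a [s <-]] := decomposition_surj x.
exists (F (a, 1)); split.
  by split; [exists a | apply/coset_eqP; rewrite !coset_decomposition].
move=> _ [[b _ <-] /coset_eqP].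
by rewrite !coset_decomposition => /underlying_inj ->.
Qed.

Lemma decomposition_data_triple : data_triple (underlying F) Sigma.
Proof. exact: conj underlying_iso decomposition_transversal. Qed.

Lemma rep_decomposition sigma : rep (underlying F) Sigma sigma = F (sigma, 1).
Proof.
have [[a _ <-]] := rep_spec decomposition_data_triple sigma.
by move=> /underlying_inj ->.
Qed.

(** Multiplicativity of [F] at [(a, s)] and [(b, t)] reads [(F (a, 1) * s) * (F (b, 1) * t) = F (a *
    b, 1) * A a b s t], and left division recovers [A a b s t]. *)
Lemma decomposition_triple_extension :
  A = triple_extension decomposition_data_triple.
Proof.
apply: albert_extension_eq => a b s t; apply/esym/triple_nablaE.
by rewrite !rep_decomposition -!decompositionE -FM.
Qed.

End DecompositionToTriple.

(** Both loops in (2) have carrier [K * subloop N], so their equality is one of extensions; [T] is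
    quantified because [triple_extension] takes it as an argument. *)
Theorem theorem12 (L : loopType) :
  (forall (N : normal_subloop L) (K : loopType)
     (kappa : K -> quotient N) (Sigma : set L)
     (T : data_triple kappa Sigma),
     albert_decomposition (triple_map (T := T)) /\
     underlying (triple_map (T := T)) = kappa) /\
  (forall (N : normal_subloop L) (K : loopType)
     (A : albert_extension K (subloop N)) (F : albert_loop A -> L),
     albert_decomposition F ->
     exists T : data_triple (fun sigma : K => coset N (F (sigma, 1)))
                            [set F (sigma, 1) | sigma in [set: K]],
       A = triple_extension T).
Proof.
split=> [N K kappa Sigma T|N K A F FD].
  by split; [exact: triple_map_decomposition | exact: underlying_triple_map].
exists (decomposition_data_triple FD); exact: decomposition_triple_extension.
Qed.
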